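(* Let $E$ be a set of equations. (1) If $t$ is a $\lambda\mu$-term with $\Gamma\vdash t:A,\Delta$ where $\Delta=\alpha_1:B_1,\dots,\alpha_m:B_m$, then $\Gamma,\neg\Delta\vdash' t^*:A$, where $\neg\Delta=\alpha_1:\neg B_1,\dots,\alpha_m:\neg B_m$. (2) If $t$ is a $\lambda\mu^{++}$-term with $\Gamma\vdash' t:A$, where $\Gamma=x_1:A_1,\dots,x_n:A_n,\alpha_1:\neg B_1,\dots,\alpha_m:\neg B_m$, then $\Gamma_\lambda\vdash t^\circ:A,\Gamma_\mu,\delta:\perp$, where $\Gamma_\lambda=x_1:A_1,\dots,x_n:A_n$ and $\Gamma_\mu=\alpha_1:B_1,\dots,\alpha_m:B_m$. (All typings are with respect to $E$.)
   Context: Types: formulas of second-order predicate logic built from atomic formulas with $\perp$, $\rightarrow$, $\forall x$, $\forall X$; $\neg A=A\rightarrow\perp$. $\approx_E$ is the smallest equivalence relation with $a[\vec x:=\vec t]\approx_E b[\vec x:=\vec t]$ for every equation $a=b$ in $E$. $\lambda\mu$-terms: $t ::= x\mid\lambda x\,t\mid(t\;t)\mid\mu\alpha\,[\beta]t$. For $\Gamma=x_1:A_1,\dots,x_n:A_n$ and $\Delta=\alpha_1:B_1,\dots,\alpha_m:B_m$, $\Gamma\vdash t:A,\Delta$ is generated by: (1) $\Gamma\vdash x_i:A_i,\Delta$; (2) from $\Gamma,x:A\vdash t:B,\Delta$ infer $\Gamma\vdash\lambda x\,t:A\rightarrow B,\Delta$; (3) from $\Gamma_1\vdash u:A\rightarrow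 B,\Delta_1$ and $\Gamma_2\vdash v:A,\Delta_2$ infer $\Gamma_1,\Gamma_2\vdash(u\;v):B,\Delta_1,\Delta_2$; (4) from $\Gamma\vdash t:A,\Delta$ with $x$ not free in $\Gamma,\Delta$ infer $\Gamma\vdash t:\forall x\,A,\Delta$; (5) from $\Gamma\vdash t:\forall x\,A,\Delta$ infer $\Gamma\vdash t:A[x:=a],\Delta$ for any term $a$; (6) from $\Gamma\vdash t:A,\Delta$ with $X$ not free in $\Gamma,\Delta$ infer $\Gamma\vdash t:\forall X\,A,\Delta$; (7) from $\Gamma\vdash t:\forall X\,A,\Delta$ infer $\Gamma\vdash t:A[X:=G],\Delta$ for any formula $G$; (8) from $\Gamma\vdash t:A[x:=a],\Delta$ and $a\approx_E b$ infer $\Gamma\vdash t:A[x:=b],\Delta$; (9) from $\Gamma\vdash t:A,\beta:B,\Delta$ infer $\Gamma\vdash\mu\beta\,[\alpha]t:B,\alpha:A,\Delta$ if $\alpha\neq\beta$, and $\Gamma\vdash\mu\alpha\,[\alpha]t:B,\Delta$ if $\alpha=\beta$. $\lambda\mu^{++}$-terms: $t ::= x\mid\alpha\mid\lambda x\,t\mid\mu\alpha\,t\mid(t\;t)$. For $\Gamma=x_1:A_1,\dots,x_n:A_n,\alpha_1:\neg B_1,\dots,\alpha_m:\neg B_m$, $\Gamma\vdash' t:A$ is generated by: (1) $\Gamma\vdash' x_i:A_i$, $\Gamma\vdash'\alpha_j:\neg B_j$; (2) from $\Gamma,x:A\vdash' u:B$ infer $\Gamma\vdash'\lambda x\,u:A\rightarrow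 B$; (3) from $\Gamma_1\vdash' u:A\rightarrow B$, $\Gamma_2\vdash' v:A$ infer $\Gamma_1,\Gamma_2\vdash'(u\;v):B$; (4)-(8) as rules (4)-(8) above without $\Delta$; (9) from $\Gamma,\alpha:\neg B\vdash' u:\perp$ infer $\Gamma\vdash'\mu\alpha\,u:B$. Translation $^*$: $x^*=x$, $(\lambda x\,t)^*=\lambda x\,t^*$, $(u\;v)^*=(u^*\;v^* )$, $(\mu\alpha\,[\beta]t)^*=\mu\alpha\,(\beta\;t^* )$. Translation $^\circ$ from $\lambda\mu^{++}$-terms to $\lambda\mu$-terms, using a distinguished $\mu$-variable $\delta$ that never occurs in $\lambda\mu^{++}$-terms: $x^\circ=x$; $\alpha^\circ=\lambda x\,\mu\gamma\,[\alpha]x$ ($\gamma\neq\alpha$); $(\lambda x\,t)^\circ=\lambda x\,t^\circ$; $(\mu\alpha\,t)^\circ=\mu\alpha\,[\delta]t^\circ$; $(u\;v)^\circ=(u^\circ\;v^\circ)$.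
   Formalization: In typing rule (9) of the λμ-calculus, case α=β, the formal rule also requires A=B (t has the type declared for α); without this, x:P ⊢ μα[α]x : Q would be derivable for all P, Q and part (1) would be false. *)

(* Defs.v *)
From mathcomp Require Import all_boot finmap.
From Stdlib Require Import Relation_Operators.

Set Implicit Arguments.
Unset Strict Implicit.
Unset Printing Implicit Defensive.

Local Open Scope fmap_scope.

Record signature := Signature {
  fsym : Type;
  farity : fsym -> nat;
  psym : Type;
  parity : psym -> nat
}.

(* Formulas are taken up to renaming of bound variables: first-order and
   second-order variables are de Bruijn indices.  Second-order variables are
   indexed separately for each arity, so that a variable is a pair (arity,
   index) and [All2 n] only captures index 0 of arity n. *)
Inductive term (S : signature) : Type :=
| TVar of nat
| TFun (f : fsym S) (args : {ffun 'I_(farity f) -> term S}).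

Arguments TVar {S} i.

Inductive form (S : signature) : Type :=
| PSym (p : psym S) (args : {ffun 'I_(parity p) -> term S})
| PVar (n i : nat) (args : {ffun 'I_n -> term S})
| Bot
| Imp of form S & form S
| All1 of form S
| All2 (n : nat) of form S.

Arguments PVar {S} n i args.
Arguments Bot {S}.
Arguments All2 {S} n A.

Definition neg S (A : form S) : form S := Imp A Bot.

Section Substitution.

Variable S : signature.
Implicit Types (A G : form S) (a t : term S).

Fixpoint tsubst (s : nat -> term S) t : term S :=
  match t with
  | TVar i => s i
  | TFun f args => TFun [ffun k => tsubst s (args k)]
  end.

Definition tshift1 : nat -> term S := fun i => TVar i.+1.

Definition up1 (s : nat -> term S) (i : nat) : term S :=
  if i is j.+1 then tsubst tshift1 (s j) else TVar 0.

Fixpoint subst1 (s : nat -> term S) A : form S :=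
  match A with
  | PSym p args => PSym [ffun k => tsubst s (args k)]
  | PVar n i args => PVar n i [ffun k => tsubst s (args k)]
  | Bot => Bot
  | Imp B C => Imp (subst1 s B) (subst1 s C)
  | All1 B => All1 (subst1 (up1 s) B)
  | All2 n B => All2 n (subst1 s B)
  end.

Definition shift1 A : form S := subst1 tshift1 A.

Definition inst1 a A : form S :=
  subst1 (fun i => if i is j.+1 then TVar j else a) A.

Definition upren2 (m : nat) (r : nat -> nat -> nat) (n i : nat) : nat :=
  if n == m then (if i is j.+1 then (r n j).+1 else 0) else r n i.

Fixpoint ren2 (r : nat -> nat -> nat) A : form S :=
  match A with
  | PSym p args => PSym args
  | PVar n i args => PVar n (r n i) args
  | Bot => Bot
  | Imp B C => Imp (ren2 r B) (ren2 r C)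
  | All1 B => All1 (ren2 r B)
  | All2 m B => All2 m (ren2 (upren2 m r) B)
  end.

Definition shift2 (m : nat) : form S -> form S :=
  ren2 (fun n i => if n == m then i.+1 else i).

(* A formula G substituted for a second-order variable of arity n is read as
   a formula with parameters x_0, ..., x_(n-1), its first-order indices
   0, ..., n-1; index n + j of G is index j of the surrounding context. *)

Definition params (n : nat) : {ffun 'I_n -> term S} := [ffun k => TVar (val k)].

Definition app_params (n : nat) (args : {ffun 'I_n -> term S}) G : form S :=
  subst1 (fun i => if insub i is Some k then args k else TVar (i - n)) G.

Definition shift1_params (n : nat) G : form S :=
  subst1 (fun i => TVar (if i < n then i else i.+1)) G.

Definition up2 (m : nat) (s : nat -> nat -> form S) (n i : nat) : form S :=
  if n == m then
    (if i is j.+1 then shift2 m (s n j) else PVar n 0 (params n))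
  else shift2 m (s n i).

Fixpoint subst2 (s : nat -> nat -> form S) A : form S :=
  match A with
  | PSym p args => PSym args
  | PVar n i args => app_params args (s n i)
  | Bot => Bot
  | Imp B C => Imp (subst2 s B) (subst2 s C)
  | All1 B => All1 (subst2 (fun n i => shift1_params n (s n i)) B)
  | All2 m B => All2 m (subst2 (up2 m s) B)
  end.

(* A[X := G], i.e. every X(t_0, ..., t_(n-1)) of A becomes
   G[x_0 := t_0, ..., x_(n-1) := t_(n-1)], where X is index 0 of arity n. *)
Definition inst2 (n : nat) G A : form S :=
  subst2 (fun m i =>
    if m == n then (if i is j.+1 then PVar m j (params m) else G)
    else PVar m i (params m)) A.

End Substitution.

Definition equations (S : signature) := term S -> term S -> Prop.

Inductive eq_instance S (E : equations S) : term S -> term S -> Prop :=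
| EqInstance (s : nat -> term S) a b :
    E a b -> eq_instance E (tsubst s a) (tsubst s b).

Definition eqE S (E : equations S) : term S -> term S -> Prop :=
  clos_refl_sym_trans (term S) (eq_instance E).

Definition lvar := nat.
Definition mvar := nat.

Definition ctx (S : signature) := {fmap nat -> form S}.

Definition map_ctx S (f : form S -> form S) (C : ctx S) : ctx S :=
  [fmap x : domf C => f (C x)].

Definition neg_ctx S (D : ctx S) : ctx S := map_ctx (@neg S) D.

Definition compat S (C1 C2 : ctx S) : Prop :=
  forall x A1 A2, C1.[? x] = Some A1 -> C2.[? x] = Some A2 -> A1 = A2.

(* Raw syntax with named variables; [LMu a b t] is mu a [b] t. *)
Inductive lm : Type :=
| LVar of lvar
| LLam of lvar & lm
| LApp of lm & lm
| LMu of mvar & mvar & lm.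

(* In a premise, the declaration of the variable bound by the term hides any
   declaration of the same name in the rest of the context; this makes typing
   of raw terms invariant under renaming of bound variables.
   The union C1, C2 of two contexts is [C1 + C2], for contexts that agree on
   their common variables.
   "x (resp. X) not free in the context" is expressed by shifting the context.
   In [lm_mu_eq], the named term has the type declared for its name. *)
Inductive lm_typ S (E : equations S) : ctx S -> lm -> form S -> ctx S -> Prop :=
| lm_ax (C D : ctx S) x A :
    C.[? x] = Some A -> lm_typ E C (LVar x) A D
| lm_lam (C D : ctx S) x t A B :
    lm_typ E C.[x <- A] t B D -> lm_typ E C (LLam x t) (Imp A B) D
| lm_app (C1 C2 D1 D2 : ctx S) u v A B :
    compat C1 C2 -> compat D1 D2 ->
    lm_typ E C1 u (Imp A B) D1 -> lm_typ E C2 v A D2 ->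
    lm_typ E (C1 + C2)%fset (LApp u v) B (D1 + D2)%fset
| lm_all1_intro (C D : ctx S) t A :
    lm_typ E (map_ctx (@shift1 S) C) t A (map_ctx (@shift1 S) D) ->
    lm_typ E C t (All1 A) D
| lm_all1_elim (C D : ctx S) t A a :
    lm_typ E C t (All1 A) D -> lm_typ E C t (inst1 a A) D
| lm_all2_intro (C D : ctx S) t n A :
    lm_typ E (map_ctx (@shift2 S n) C) t A (map_ctx (@shift2 S n) D) ->
    lm_typ E C t (All2 n A) D
| lm_all2_elim (C D : ctx S) t n A G :
    lm_typ E C t (All2 n A) D -> lm_typ E C t (inst2 n G A) D
| lm_eq (C D : ctx S) t A a b :
    lm_typ E C t (inst1 a A) D -> eqE E a b -> lm_typ E C t (inst1 b A) D
| lm_mu_neq (C D : ctx S) t A B al be :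
    al <> be -> compat [fmap].[al <- A] D ->
    lm_typ E C t A D.[be <- B] -> lm_typ E C (LMu be al t) B D.[al <- A]
| lm_mu_eq (C D : ctx S) t B al :
    lm_typ E C t B D.[al <- B] -> lm_typ E C (LMu al al t) B D.

Inductive pp : Type :=
| PLVar of lvar
| PMVar of mvar
| PLam of lvar & pp
| PMu of mvar & pp
| PApp of pp & pp.

(* A context is split into its lambda-variables C and its mu-variables N; the
   latter are only declared with negated types. *)
Definition negated S (N : ctx S) : Prop := exists D : ctx S, N = neg_ctx D.

Inductive pp_typ S (E : equations S) : ctx S -> ctx S -> pp -> form S -> Prop :=
| pp_ax_l (C N : ctx S) x A :
    negated N -> C.[? x] = Some A -> pp_typ E C N (PLVar x) A
| pp_ax_m (C N : ctx S) al B :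
    negated N -> N.[? al] = Some (neg B) -> pp_typ E C N (PMVar al) (neg B)
| pp_lam (C N : ctx S) x u A B :
    pp_typ E C.[x <- A] N u B -> pp_typ E C N (PLam x u) (Imp A B)
| pp_app (C1 C2 N1 N2 : ctx S) u v A B :
    compat C1 C2 -> compat N1 N2 ->
    pp_typ E C1 N1 u (Imp A B) -> pp_typ E C2 N2 v A ->
    pp_typ E (C1 + C2)%fset (N1 + N2)%fset (PApp u v) B
| pp_all1_intro (C N : ctx S) t A :
    pp_typ E (map_ctx (@shift1 S) C) (map_ctx (@shift1 S) N) t A ->
    pp_typ E C N t (All1 A)
| pp_all1_elim (C N : ctx S) t A a :
    pp_typ E C N t (All1 A) -> pp_typ E C N t (inst1 a A)
| pp_all2_intro (C N : ctx S) t n A :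
    pp_typ E (map_ctx (@shift2 S n) C) (map_ctx (@shift2 S n) N) t A ->
    pp_typ E C N t (All2 n A)
| pp_all2_elim (C N : ctx S) t n A G :
    pp_typ E C N t (All2 n A) -> pp_typ E C N t (inst2 n G A)
| pp_eq (C N : ctx S) t A a b :
    pp_typ E C N t (inst1 a A) -> eqE E a b -> pp_typ E C N t (inst1 b A)
| pp_mu (C N : ctx S) al u B :
    negated N ->
    pp_typ E C N.[al <- neg B] u Bot -> pp_typ E C N (PMu al u) B.

Fixpoint star (t : lm) : pp :=
  match t with
  | LVar x => PLVar x
  | LLam x u => PLam x (star u)
  | LApp u v => PApp (star u) (star v)
  | LMu al be u => PMu al (PApp (PMVar be) (star u))
  end.

(* Both free and binding occurrences count. *)
Fixpoint mu_occurs (d : mvar) (t : pp) : bool :=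
  match t with
  | PLVar _ => false
  | PMVar al => al == d
  | PLam _ u => mu_occurs d u
  | PMu al u => (al == d) || mu_occurs d u
  | PApp u v => mu_occurs d u || mu_occurs d v
  end.

(* The argument d is the distinguished variable delta; the bound variable
   gamma of the clause for mu-variables is chosen distinct from alpha and d. *)
Fixpoint circ (d : mvar) (t : pp) : lm :=
  match t with
  | PLVar x => LVar x
  | PMVar al => LLam 0 (LMu (maxn al d).+1 al (LVar 0))
  | PLam x u => LLam x (circ d u)
  | PMu al u => LMu al d (circ d u)
  | PApp u v => LApp (circ d u) (circ d v)
  end.

(* Main.v *)
Require Import Defs.
From mathcomp Require Import all_boot finmap.

Set Implicit Arguments.
Unset Strict Implicit.
Unset Printing Implicit Defensive.

Local Open Scope fmap_scope.

(** Both parts go by induction on the typing derivation, where only names need work. In the forward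
    direction, naming [[al]t] with [t : A] becomes the application of [al : neg A] to [star t],
    which has type [Bot] as the [mu] rule wants ([star_typ]). In the backward direction, a variable
    [al : neg B] becomes [LLam x (LMu g al x)]: its body names [x : B] by [al] and has type [Bot],
    so the term has type [neg B]. A body of type [Bot] under [mu] is named by [delta : Bot]
    ([circ_typ]). The rest is bookkeeping on contexts: unions, negation and shifts commute, and a
    union that is negated splits into negated halves. *)

Lemma fnd_map_ctx (S : signature) (f : form S -> form S) (C : ctx S) x :
  (map_ctx f C).[? x] = omap f C.[? x].
Proof.
rewrite /map_ctx; case: (boolP (x \in domf C)) => xC; last first.
  by rewrite !not_fnd.
rewrite (in_fnd (f := [fmap y : domf C => f (C y)]) xC) ffunE in_fnd /=.
by congr (Some (f _)).
Qed.

Lemma fnd_catE (S : signature) (C1 C2 : ctx S) x :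
  (C1 + C2)%fset.[? x] = if C2.[? x] is Some A then Some A else C1.[? x].
Proof. by rewrite fnd_cat; case: fndP. Qed.

(** The right context wins in [+]; compatibility makes the choice immaterial. *)
Lemma fnd_cat_compat (S : signature) (C1 C2 : ctx S) x :
  compat C1 C2 ->
  (C1 + C2)%fset.[? x] = if C1.[? x] is Some A then Some A else C2.[? x].
Proof.
move=> C12; rewrite fnd_catE.
case E1: C1.[? x] => [A1|]; case E2: C2.[? x] => [A2|] //.
by rewrite (C12 _ _ _ E1 E2).
Qed.

Lemma map_ctx_comp (S : signature) (f g : form S -> form S) (C : ctx S) :
  map_ctx f (map_ctx g C) = map_ctx (f \o g) C.
Proof. by apply/fmapP => x; rewrite !fnd_map_ctx; case: C.[? x]. Qed.

Lemma map_ctx_set (S : signature) (f : form S -> form S) (C : ctx S) x A :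
  map_ctx f C.[x <- A] = (map_ctx f C).[x <- f A].
Proof.
by apply/fmapP => y; rewrite fnd_map_ctx !fnd_set fnd_map_ctx; case: eqP.
Qed.

Lemma map_ctx_cat (S : signature) (f : form S -> form S) (C1 C2 : ctx S) :
  map_ctx f (C1 + C2)%fset = (map_ctx f C1 + map_ctx f C2)%fset.
Proof.
apply/fmapP => y; rewrite fnd_map_ctx !fnd_catE !fnd_map_ctx.
by case: C2.[? y].
Qed.

Lemma neg_inj (S : signature) : injective (@neg S).
Proof. by move=> A B []. Qed.

Lemma neg_ctx_inj (S : signature) : injective (@neg_ctx S).
Proof.
move=> C D /fmapP eqCD; apply/fmapP => x.
have := eqCD x; rewrite !fnd_map_ctx.
by case: C.[? x] => [A|]; case: D.[? x] => [B|] //= [->].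
Qed.

Lemma compat_map_ctx (S : signature) (f : form S -> form S) (C1 C2 : ctx S) :
  compat C1 C2 -> compat (map_ctx f C1) (map_ctx f C2).
Proof.
move=> C12 x A1 A2; rewrite !fnd_map_ctx.
case E1: C1.[? x] => [B1|] //= -[<-]; case E2: C2.[? x] => [B2|] //= -[<-].
by rewrite (C12 _ _ _ E1 E2).
Qed.

Lemma compat_neg_ctx (S : signature) (D1 D2 : ctx S) :
  compat (neg_ctx D1) (neg_ctx D2) -> compat D1 D2.
Proof.
move=> D12 x A1 A2 E1 E2; apply: neg_inj; apply: (D12 x).
  by rewrite fnd_map_ctx E1.
by rewrite fnd_map_ctx E2.
Qed.

(** The witness is [D] restricted to the domain of [N]. This serves to un-negate the two contexts of
    an application. *)
Lemma negated_sub (S : signature) (N D : ctx S) :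
  (forall x A, N.[? x] = Some A -> (neg_ctx D).[? x] = Some A) -> negated N.
Proof.
move=> ND; exists D.[& domf N]; apply/fmapP => x.
rewrite fnd_map_ctx fnd_restrict.
case: (fndP N x) => // xN.
by rewrite -fnd_map_ctx (ND x N.[xN]) // in_fnd.
Qed.

(* The left premise of the application only declares al, so that no weakening
   is needed. *)
Lemma pp_typ_named (S : signature) (E : equations S) (C D : ctx S) al t A :
  compat [fmap].[al <- A] D ->
  pp_typ E C (neg_ctx D) t A ->
  pp_typ E C (neg_ctx ([fmap].[al <- A] + D)%fset) (PApp (PMVar al) t) Bot.
Proof.
move=> alD tA; rewrite -(cat0f C) /neg_ctx map_ctx_cat.
apply: pp_app tA => //; first by move=> x A1 A2; rewrite fnd_fmap0.
  exact: compat_map_ctx.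
by apply: pp_ax_m; [exists [fmap].[al <- A]|rewrite fnd_map_ctx fnd_set eqxx].
Qed.

Lemma star_typ (S : signature) (E : equations S) t (C D : ctx S) A :
  lm_typ E C t A D -> pp_typ E C (neg_ctx D) (star t) A.
Proof.
elim=> {t C D A} /=.
- by move=> C D x A xA; apply: pp_ax_l => //; exists D.
- by move=> C D x t A B _; apply: pp_lam.
- move=> C1 C2 D1 D2 u v A B C12 D12 _ uAB _ vA.
  rewrite /neg_ctx map_ctx_cat; apply: pp_app uAB vA => //.
  exact: compat_map_ctx.
- move=> C D t A _; rewrite /neg_ctx map_ctx_comp => tA.
  by apply: pp_all1_intro; rewrite map_ctx_comp.
- by move=> C D t A a _; apply: pp_all1_elim.
- move=> C D t n A _; rewrite /neg_ctx map_ctx_comp => tA.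
  by apply: pp_all2_intro; rewrite map_ctx_comp.
- by move=> C D t n A G _; apply: pp_all2_elim.
- by move=> C D t A a b _ tA ab; apply: pp_eq tA ab.
- move=> C D t A B al be /eqP al_be alD _ tA.
  apply: pp_mu; first by exists D.[al <- A].
  (* Since [al] and [be] differ, the bound [be] cannot clash with the declaration of [al]. *)
  have albeD : compat [fmap].[al <- A] D.[be <- B].
    move=> x A1 A2 xA1; rewrite fnd_set; case: (x =P be) => [eqx|_].
      by move: xA1; rewrite eqx fnd_set eq_sym (negPf al_be) fnd_fmap0.
    exact: alD xA1.
  have := pp_typ_named albeD tA; rewrite /neg_ctx -map_ctx_set.
  suff -> : ([fmap].[al <- A] + D.[be <- B])%fset = D.[al <- A].[be <- B] by [].
  apply/fmapP => x; rewrite fnd_cat_compat // !fnd_set fnd_fmap0.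
  by case: (x =P al) => // ->; rewrite (negPf al_be).
- move=> C D t B al _ tB; apply: pp_mu; first by exists D.
  have alD : compat [fmap].[al <- B] D.[al <- B].
    by move=> x A1 A2; rewrite !fnd_set fnd_fmap0; case: eqP => // _ [<-] [].
  have := pp_typ_named alD tB; rewrite /neg_ctx -map_ctx_set.
  suff -> : ([fmap].[al <- B] + D.[al <- B])%fset = D.[al <- B] by [].
  apply/fmapP => x; rewrite fnd_cat_compat // !fnd_set fnd_fmap0.
  by case: eqP.
Qed.

Lemma set_known (S : signature) (C : ctx S) x A :
  C.[? x] = Some A -> C.[x <- A] = C.
Proof.
by move=> xA; apply/fmapP => y; rewrite fnd_set; case: eqP => // ->.
Qed.

Lemma compat_set1 (S : signature) (C : ctx S) x A :
  C.[? x] = Some A -> compat [fmap].[x <- A] C.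
Proof.
move=> xA y A1 A2; rewrite fnd_set fnd_fmap0; case: eqP => // -> [<-].
by rewrite xA => -[].
Qed.

(** The typing rule adds [al : A] to the context; when it is already declared there, this changes
    nothing. *)
Lemma lm_mu_declared (S : signature) (E : equations S) (C D : ctx S) t A B
    al be :
  al <> be -> D.[? al] = Some A ->
  lm_typ E C t A D.[be <- B] -> lm_typ E C (LMu be al t) B D.
Proof.
move=> al_be alA tA; rewrite -(set_known alA).
by apply: lm_mu_neq tA => //; apply: compat_set1.
Qed.

(** The equation [N = neg_ctx D] keeps the context of the derivation a variable, so that the
    induction goes through; each case finds its own [D]. *)
Lemma circ_typ (S : signature) (E : equations S) d t (C N : ctx S) A :
  pp_typ E C N t A -> forall D : ctx S, N = neg_ctx D ->
  ~~ mu_occurs d t -> d \notin domf D ->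
  lm_typ E C (circ d t) A D.[d <- Bot].
Proof.
elim=> {t C N A} /=.
- by move=> C N x A _ xA D _ _ _; apply: lm_ax.
- move=> C N al B _ alB D eqN al_d dD; apply: lm_lam.
  have alD : D.[? al] = Some B.
    by move: alB; rewrite eqN fnd_map_ctx; case: D.[? al] => //= A [->].
  apply: (@lm_mu_declared _ _ _ _ _ B).
  (* The bound name [(maxn al d).+1] exceeds [al]. *)
  + by apply/eqP; rewrite neq_ltn ltnS leq_maxl.
  + by rewrite fnd_set (negPf al_d).
  + by apply: lm_ax; rewrite fnd_set eqxx.
- by move=> C N x u A B _ IH D eqN ud dD; apply: lm_lam; apply: IH.
- move=> C1 C2 N1 N2 u v A B C12 N12 _ IHu _ IHv D eqN.
  rewrite negb_or => /andP[ud vd] dD.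
  have [D1 eqN1] : negated N1.
    by apply: (@negated_sub _ _ D) => x G xG; rewrite -eqN fnd_cat_compat ?xG.
  have [D2 eqN2] : negated N2.
    by apply: (@negated_sub _ _ D) => x G xG; rewrite -eqN fnd_catE ?xG.
  subst N1 N2; have eqD : D = (D1 + D2)%fset.
    by apply: neg_ctx_inj; rewrite -eqN [RHS]map_ctx_cat.
  move: dD; rewrite {}eqD mem_catf negb_or => /andP[dD1 dD2].
  have D12 := compat_neg_ctx N12.
  (* Both premises carry [d : Bot]; the union merges the two copies. *)
  have -> : (D1 + D2)%fset.[d <- Bot] = (D1.[d <- Bot] + D2.[d <- Bot])%fset.
    by apply/fmapP => x; rewrite fnd_catE !fnd_set fnd_catE; case: eqP.
  apply: lm_app (IHu _ _ _ _) (IHv _ _ _ _) => //.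
  move=> x A1 A2; rewrite !fnd_set; case: eqP => [_ [<-] [] //|_].
  exact: D12.
- move=> C N t A _ IH D eqN td dD; apply: lm_all1_intro.
  (* Shifting fixes [Bot], so the declaration of [d] is preserved. *)
  rewrite map_ctx_set; apply: IH => //.
  by rewrite eqN /neg_ctx !map_ctx_comp.
- by move=> C N t A a _ IH D eqN td dD; apply: lm_all1_elim; apply: IH.
- move=> C N t n A _ IH D eqN td dD; apply: lm_all2_intro.
  rewrite map_ctx_set; apply: IH => //.
  by rewrite eqN /neg_ctx !map_ctx_comp.
- by move=> C N t n A G _ IH D eqN td dD; apply: lm_all2_elim; apply: IH.
- move=> C N t A a b _ IH ab D eqN td dD.
  by apply: lm_eq ab; apply: IH.
- move=> C N al u B _ _ IH D eqN.
  rewrite negb_or => /andP[al_d ud] dD.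
  (* mu al u becomes mu al [d] u, where the declaration d : Bot of the target
     context absorbs the body, of type Bot. *)
  apply: (@lm_mu_declared _ _ _ _ _ Bot).
  + by apply/eqP; rewrite eq_sym.
  + by rewrite fnd_set eqxx.
  (* The distinct names [al] and [d] commute, which puts [d] last as in the induction hypothesis at
     [D.[al <- B]]. *)
  + rewrite setfC (negPf al_d); apply: IH => //.
      by rewrite eqN /neg_ctx map_ctx_set.
    by rewrite mem_setf !inE eq_sym negb_or al_d.
Qed.

Theorem theorem5 (S : signature) (E : equations S) :
  (forall (t : lm) (Gam Del : ctx S) (A : form S),
     lm_typ E Gam t A Del ->
     pp_typ E Gam (neg_ctx Del) (star t) A)
  /\
  (forall (delta : mvar) (t : pp) (Gam_l Gam_m : ctx S) (A : form S),
     ~~ mu_occurs delta t -> delta \notin domf Gam_m ->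
     pp_typ E Gam_l (neg_ctx Gam_m) t A ->
     lm_typ E Gam_l (circ delta t) A Gam_m.[delta <- Bot]).
Proof.
split; first by move=> t Gam Del A; apply: star_typ.
by move=> d t Gl Gm A td dGm tA; exact: (circ_typ tA).
Qed.
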